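(* Let $(E,K,F,\nabla)$ be a crossed module of Lie algebroids over a smooth manifold $M$. Let $E_H$ be the strict BLA of $E$ (with respect to the strict $K$-adjustment $(\nabla,\zeta\equiv0)$). Then $(E_H,-K,F,\nabla)$ is also a crossed module of Lie algebroids, and the canonical sandglass sequence of $(E,K,F,\nabla)$ induced by $(\nabla,\zeta\equiv0)$ is a butterfly between $(E,K,F,\nabla)$ and $(E_H,-K,F,\nabla)$ for which both diagonals are short exact sequences of Lie algebroids.
   Context: Everything is smooth. For a Lie algebroid $A\to M$, $\rho_A$ is its anchor and $[\cdot,\cdot]_A$ its bracket; morphisms over $M$ cover the identity. A BLA (bundle of Lie algebras) is a vector bundle with a smooth field of Lie brackets on its fibres, viewed as a Lie algebroid with zero anchor; an LAB is a BLA all of whose fibres are isomorphic Lie algebras. An $F$-connection on $E$ is an $\mathbb R$-bilinear map $\nabla\colon\Gamma(F)\times\Gamma(E)\to\Gamma(E)$, $C^\infty(M)$-linear in the first argument, with $\nabla_X(f\mu)=f\nabla_X\mu+(\rho_F(X)f)\mu$; it is flat if $[\nabla_X,\nabla_Y]=\nabla_{[X,Y]_F}$. Crossed module of Lie algebroids: a quadruple $(E,K,F,\nabla)$ with $E\to M$ an LAB, $F\to M$ a Lie algebroid, $K\colon E\to F$ a morphism of Lie algebroids, $\nabla$ a flat $F$-connection on $E$, such that $\nabla_X([\mu,\nu]_E)=[\nabla_X\mu,\nu]_E+[\mu,\nabla_X\nu]_E$, $K(\nabla_X\mu)=[X,K(\mu)]_F$ and $\nabla_{K(\mu)}\nu=[\mu,\nu]_E$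 for all $X\in\Gamma(F)$, $\mu,\nu\in\Gamma(E)$. Put $\nabla^{\mathrm{bas}}_\mu\nu=[\mu,\nu]_E+\nabla_{K(\nu)}\mu$ and $\nabla^{\mathrm{bas}}_\mu X=[K(\mu),X]_F+K(\nabla_X\mu)$ (basic $K$-connection). For a crossed module both vanish, and $(\nabla,\zeta\equiv0)$ is a strict $K$-adjustment. The associated strict BLA $E_H$ of $E$ is the vector bundle $E$ with field of Lie brackets $H(\mu,\nu)=\nabla^{\mathrm{bas}}_\mu\nu-\nabla^{\mathrm{bas}}_\nu\mu-[\mu,\nu]_E$, which here equals $-[\mu,\nu]_E$. The canonical sandglass sequence of $(E,K,F,\nabla)$ consists of the Lie algebroid $A=F\oplus E$ with anchor $\rho_A(X,\mu)=\rho_F(X)+\rho_E(\mu)$ and bracket $[(X,\mu),(Y,\nu)]_A=\bigl([X,Y]_F+\nabla^{\mathrm{bas}}_\mu Y-\nabla^{\mathrm{bas}}_\nu X,\ [\mu,\nu]_E+\nabla_X\nu-\nabla_Y\mu\bigr)$, together with the maps $\hat\iota\colon E\to A$, $\mu\mapsto(0,\mu)$; $\mathscr D\colon A\to F$, $(X,\mu)\mapsto X+K(\mu)$; $\iota\colon E_H\to A$, $\mu\mapsto(-K(\mu),\mu)$; $\psi\colon A\to F$, $(X,\mu)\mapsto X$; and $K\colon E\to F$, $-K\colon E_H\to F$. Butterfly between crossed modules $(E,K,F,\nabla)$ and $(E',K',F',\nabla')$ over $M$: a Lie algebroid $A\to M$ and Lie algebroid morphisms $\hat\iota\colon E\to A$,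 $\iota\colon E'\to A$ (injective), $\mathscr D\colon A\to F$ (surjective), $\psi\colon A\to F'$ with $\mathscr D\circ\hat\iota=K$ and $\psi\circ\iota=K'$, such that the diagonal $E'\xrightarrow{\iota}A\xrightarrow{\mathscr D}F$ is a short exact sequence and the diagonal $E\xrightarrow{\hat\iota}A\xrightarrow{\psi}F'$ is a complex, and such that $[\xi,\hat\iota(\mu)]_A=\hat\iota(\nabla_{\mathscr D(\xi)}\mu)$ and $[\xi,\iota(\nu)]_A=\iota(\nabla'_{\psi(\xi)}\nu)$ for all $\mu\in\Gamma(E)$, $\nu\in\Gamma(E')$, $\xi\in\Gamma(A)$. The two diagonals of the diagram are $E'\to A\to F$ and $E\to A\to F'$. *)

(* Defs.v *)
From HB Require Import structures.
From mathcomp Require Import all_boot all_order all_algebra.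
From mathcomp Require Import all_classical all_reals all_analysis.
Import Order.TTheory GRing.Theory Num.Theory numFieldNormedType.Exports.

Set Implicit Arguments.
Unset Strict Implicit.
Unset Printing Implicit Defensive.

Local Open Scope classical_set_scope.
Local Open Scope ring_scope.

(* Smooth functions on open subsets of R^n.  All conditions are pointwise on
   [U]; they have their usual meaning when [U] is open. *)

Fixpoint Ck (R : realType) (n k : nat) (U : set 'rV[R]_n) (f : 'rV[R]_n -> R)
    : Prop :=
  (forall x, U x -> {for x, continuous f}) /\
  match k with
  | 0 => True
  | k'.+1 => forall i : 'I_n,
      (forall x, U x -> derivable f x 'e_i) /\ Ck k' U ('D_'e_i f)
  end.

Definition Cinfty (R : realType) (n : nat) (U : set 'rV[R]_n)
    (f : 'rV[R]_n -> R) : Prop :=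
  forall k, Ck k U f.

(* A chart is given by total functions [cmap] and [cinv], which are meaningful
   only on [cdom] and on [cmap @` cdom] respectively. *)

Record chart (R : realType) (T : topologicalType) (n : nat) := Chart {
  cdom : set T;
  cmap : T -> 'rV[R]_n;
  cinv : 'rV[R]_n -> T }.

Record is_chart (R : realType) (T : topologicalType) (n : nat)
    (c : chart R T n) : Prop := IsChart {
  cdom_open : open (cdom c);
  cimg_open : open (cmap c @` cdom c);
  cmapK : forall x, cdom c x -> cinv c (cmap c x) = x;
  cmap_cont : {within cdom c, continuous (cmap c)};
  cinv_cont : {within cmap c @` cdom c, continuous (cinv c)} }.

(* The atlas is not required to be maximal. *)
Record manifold (R : realType) := Manifold {
  mcarrier :> topologicalType;
  mdim : nat;
  atlas : set (chart R mcarrier mdim);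
  m_hausdorff : hausdorff_space mcarrier;
  m_second_countable : @second_countable mcarrier;
  atlas_chart : forall c, atlas c -> is_chart c;
  atlas_cover : forall x, exists2 c, atlas c & cdom c x;
  atlas_compat : forall c d, atlas c -> atlas d -> forall i : 'I_mdim,
    Cinfty (cmap c @` (cdom c `&` cdom d)) (fun y => cmap d (cinv c y) 0 i) }.

Section SmoothFunctions.
Variables (R : realType) (M : manifold R).

Definition smooth_on (U : set M) (f : M -> R) : Prop :=
  forall c, atlas c -> Cinfty (cmap c @` (U `&` cdom c)) (f \o cinv c).

Definition smooth (f : M -> R) : Prop := smooth_on setT f.

(* T_x M as the space of derivations of C^oo(M) at x; the values of [v] at
   non-smooth functions are irrelevant, so that two tangent vectors are
   considered equal when they agree on smooth functions. *)
Definition is_tangent (x : M) (v : (M -> R) -> R) : Prop :=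
  (forall (a : R) f g, smooth f -> smooth g ->
     v (fun y => a * f y + g y) = a * v f + v g) /\
  (forall f g, smooth f -> smooth g ->
     v (fun y => f y * g y) = f x * v g + g x * v f).

End SmoothFunctions.

(* Vector bundles: a family of fibres with local trivialisations [tmap],
   fibrewise linear bijections over [tdom] with inverse [tinv], and smooth
   transition functions. *)

Record ltriv (R : realType) (M : manifold R) (E : M -> lmodType R) (r : nat) :=
  LTriv {
  tdom : set M;
  tmap : forall x, E x -> 'rV[R]_r;
  tinv : forall x, 'rV[R]_r -> E x }.

Record vbundle (R : realType) (M : manifold R) := VBundle {
  fib :> M -> lmodType R;
  rk : nat;
  trivs : set (ltriv fib rk);
  triv_open : forall t, trivs t -> open (tdom t);
  triv_cover : forall x, exists2 t, trivs t & tdom t x;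
  triv_linear : forall t x, trivs t -> tdom t x -> linear (@tmap _ _ _ _ t x);
  tmapK : forall t x, trivs t -> tdom t x ->
    cancel (@tmap _ _ _ _ t x) (@tinv _ _ _ _ t x);
  tinvK : forall t x, trivs t -> tdom t x ->
    cancel (@tinv _ _ _ _ t x) (@tmap _ _ _ _ t x);
  triv_compat : forall s t, trivs s -> trivs t ->
    forall (v : 'rV[R]_rk) (i : 'I_rk),
      smooth_on (tdom s `&` tdom t) (fun x => tmap t (tinv s x v) 0 i) }.

Section Bundles.
Variables (R : realType) (M : manifold R).

Definition sect (E : vbundle M) : Type := forall x, E x.

Definition smooth_sect_on (E : vbundle M) (U : set M) (s : sect E) : Prop :=
  forall t, trivs t -> forall i : 'I_(rk E),
    smooth_on (U `&` tdom t) (fun x => tmap t (s x) 0 i).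

(* Gamma(E) *)
Definition smooth_sect (E : vbundle M) (s : sect E) : Prop :=
  smooth_sect_on setT s.

(* Smoothness of fibrewise maps is tested on local sections over all open
   sets; local frames being among these, this is smoothness of the
   coefficients in local trivialisations. *)
Record is_bundle_map (E F : vbundle M) (phi : forall x, E x -> F x) : Prop :=
  IsBundleMap {
  bmap_linear : forall x, linear (phi x);
  bmap_smooth : forall (U : set M) (s : sect E), open U ->
    smooth_sect_on U s -> smooth_sect_on U (fun x => phi x (s x) : F x) }.

Definition smap (E F : vbundle M) (phi : forall x, E x -> F x) (s : sect E)
    : sect F :=
  fun x => phi x (s x).

End Bundles.

Section DirectSum.
Variables (R : realType) (M : manifold R) (F E : vbundle M).

Definition dsum_fib (x : M) : lmodType R := (F x * E x)%type.

Definition dsum_triv (s : ltriv F (rk F)) (t : ltriv E (rk E))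
    : ltriv dsum_fib (rk F + rk E) :=
  LTriv (tdom s `&` tdom t)
    (fun x (p : dsum_fib x) => row_mx (tmap s p.1) (tmap t p.2))
    (fun x v => (tinv s x (lsubmx v), tinv t x (rsubmx v)) : dsum_fib x).

Definition dsum_trivs : set (ltriv dsum_fib (rk F + rk E)) :=
  [set u | exists s t, [/\ trivs s, trivs t & u = dsum_triv s t]].

Lemma dsum_triv_open u : dsum_trivs u -> open (tdom u).
Proof.
move=> [s [t [sF tE ->]]]; apply: openI; exact: triv_open.
Qed.

Lemma dsum_triv_cover x : exists2 u, dsum_trivs u & tdom u x.
Proof.
have [s sF sx] := triv_cover F x; have [t tE tx] := triv_cover E x.
by exists (dsum_triv s t) => //; exists s, t.
Qed.

Lemma dsum_triv_linear u x :
  dsum_trivs u -> tdom u x -> linear (@tmap _ _ _ _ u x).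
Proof.
move=> [s [t [sF tE ->]]] /= [sx tx] a p q /=.
by rewrite (triv_linear sF sx) (triv_linear tE tx) scale_row_mx add_row_mx.
Qed.

Lemma dsum_tmapK u x : dsum_trivs u -> tdom u x ->
  cancel (@tmap _ _ _ _ u x) (@tinv _ _ _ _ u x).
Proof.
move=> [s [t [sF tE ->]]] /= [sx tx] [p q] /=.
by rewrite row_mxKl row_mxKr (tmapK sF sx) (tmapK tE tx).
Qed.

Lemma dsum_tinvK u x : dsum_trivs u -> tdom u x ->
  cancel (@tinv _ _ _ _ u x) (@tmap _ _ _ _ u x).
Proof.
move=> [s [t [sF tE ->]]] /= [sx tx] v /=.
by rewrite (tinvK sF sx) (tinvK tE tx) hsubmxK.
Qed.

Lemma Ck_subset n k (U V : set 'rV[R]_n) f : U `<=` V -> Ck k V f -> Ck k U f.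
Proof.
move=> UV; elim: k f => [|k IH] f /= [fc fd]; split=> //.
- by move=> x /UV/fc.
- by move=> x /UV/fc.
- by move=> i; have [di /IH ?] := fd i; split=> // x /UV/di.
Qed.

Lemma smooth_on_subset (U V : set M) (f : M -> R) :
  U `<=` V -> smooth_on V f -> smooth_on U f.
Proof.
move=> UV fV c /fV fc k; apply: Ck_subset (fc k).
by move=> _ [x [Ux cx] <-]; exists x => //; split=> //; exact: UV.
Qed.

Lemma dsum_triv_compat u w : dsum_trivs u -> dsum_trivs w ->
  forall (v : 'rV[R]_(rk F + rk E)) (i : 'I_(rk F + rk E)),
    smooth_on (tdom u `&` tdom w) (fun x => tmap w (tinv u x v) 0 i).
Proof.
move=> [s [t [sF tE ->]]] [s' [t' [sF' tE' ->]]] v i /=.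
case: (split_ordP i) => j ->.
- under eq_fun do rewrite row_mxEl.
  apply: smooth_on_subset (triv_compat sF sF' (lsubmx v) j).
  by move=> x [[? ?] [? ?]].
- under eq_fun do rewrite row_mxEr.
  apply: smooth_on_subset (triv_compat tE tE' (rsubmx v) j).
  by move=> x [[? ?] [? ?]].
Qed.

Definition dsum : vbundle M :=
  VBundle dsum_triv_open dsum_triv_cover dsum_triv_linear dsum_tmapK
    dsum_tinvK dsum_triv_compat.

End DirectSum.

(* Lie algebroids.  [la_br] is a total operation on set-theoretic sections; it
   is constrained, and used, on smooth sections only.  The same applies to
   connections below. *)

Record pre_algebroid (R : realType) (M : manifold R) := PreAlgebroid {
  la_bundle :> vbundle M;
  anchor : forall x, la_bundle x -> (M -> R) -> R;
  la_br : sect la_bundle -> sect la_bundle -> sect la_bundle }.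

Section LieAlgebroids.
Variables (R : realType) (M : manifold R).

(* Skew-symmetry and linearity in the first argument give bilinearity. *)
Record is_lie_algebroid (A : pre_algebroid M) : Prop := IsLieAlgebroid {
  anchor_tangent : forall x (a : A x), is_tangent x (anchor a);
  anchor_linear : forall x (c : R) (a b : A x) f, smooth f ->
    anchor (c *: a + b) f = c * anchor a f + anchor b f;
  anchor_smooth : forall (U : set M) (s : sect A) f, open U ->
    smooth_sect_on U s -> smooth f -> smooth_on U (fun x => anchor (s x) f);
  la_br_smooth : forall s t : sect A, smooth_sect s -> smooth_sect t ->
    smooth_sect (la_br s t);
  la_br_skew : forall s t : sect A, smooth_sect s -> smooth_sect t ->
    forall x, la_br s t x = - la_br t s x;
  la_br_linear : forall (c : R) (r s t : sect A),
    smooth_sect r -> smooth_sect s -> smooth_sect t ->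
    forall x, la_br (fun y => c *: r y + s y) t x
              = c *: la_br r t x + la_br s t x;
  la_br_jacobi : forall r s t : sect A,
    smooth_sect r -> smooth_sect s -> smooth_sect t ->
    forall x, la_br r (la_br s t) x + la_br s (la_br t r) x
              + la_br t (la_br r s) x = 0;
  la_br_leibniz : forall (f : M -> R) (s t : sect A),
    smooth f -> smooth_sect s -> smooth_sect t ->
    forall x, la_br s (fun y => f y *: t y) x
              = f x *: la_br s t x + anchor (s x) f *: t x;
  anchor_br : forall (s t : sect A) f,
    smooth_sect s -> smooth_sect t -> smooth f ->
    forall x, anchor (la_br s t x) f
              = anchor (s x) (fun y => anchor (t y) f)
                - anchor (t x) (fun y => anchor (s y) f) }.

Record is_la_morphism (A B : pre_algebroid M) (phi : forall x, A x -> B x)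
    : Prop := IsLAMorphism {
  lam_bundle_map : is_bundle_map phi;
  lam_anchor : forall x (a : A x) f, smooth f ->
    anchor (phi x a) f = anchor a f;
  lam_br : forall s t : sect A, smooth_sect s -> smooth_sect t ->
    forall x, phi x (la_br s t x) = la_br (smap phi s) (smap phi t) x }.

Record is_ses (A B C : pre_algebroid M) (i : forall x, A x -> B x)
    (p : forall x, B x -> C x) : Prop := IsSES {
  ses_mor_l : is_la_morphism i;
  ses_mor_r : is_la_morphism p;
  ses_inj : forall x, injective (i x);
  ses_exact : forall x (b : B x), p x b = 0 <-> exists a, b = i x a;
  ses_surj : forall x (c : C x), exists b, c = p x b }.

End LieAlgebroids.

Record is_lie_bracket (R : realType) (V : lmodType R) (br : V -> V -> V)
    : Prop := IsLieBracket {
  lie_skew : forall u v, br u v = - br v u;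
  lie_linear : forall (c : R) u v w, br (c *: u + v) w = c *: br u w + br v w;
  lie_jacobi : forall u v w, br u (br v w) + br v (br w u) + br w (br u v) = 0 }.

Definition lie_isomorphic (R : realType) (V W : lmodType R)
    (brV : V -> V -> V) (brW : W -> W -> W) : Prop :=
  exists phi : V -> W, [/\ linear phi, bijective phi &
    forall u v, phi (brV u v) = brW (phi u) (phi v)].

Record pre_bla (R : realType) (M : manifold R) := PreBLA {
  bla_bundle :> vbundle M;
  bla_br : forall x, bla_bundle x -> bla_bundle x -> bla_bundle x }.

Section BLA.
Variables (R : realType) (M : manifold R).

Definition bla_algebroid (E : pre_bla M) : pre_algebroid M :=
  @PreAlgebroid R M E (fun x _ _ => 0) (fun s t x => bla_br (s x) (t x)).

Record is_BLA (E : pre_bla M) : Prop := IsBLA {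
  bla_bracket : forall x, is_lie_bracket (@bla_br R M E x);
  bla_smooth : forall (U : set M) (s t : sect E), open U ->
    smooth_sect_on U s -> smooth_sect_on U t ->
    smooth_sect_on U (fun x => bla_br (s x) (t x) : E x) }.

Record is_LAB (E : pre_bla M) : Prop := IsLAB {
  lab_bla : is_BLA E;
  lab_iso : forall x y, lie_isomorphic (@bla_br R M E x) (@bla_br R M E y) }.

Record is_connection (F : pre_algebroid M) (E : vbundle M)
    (nabla : sect F -> sect E -> sect E) : Prop := IsConnection {
  conn_smooth : forall X mu, smooth_sect X -> smooth_sect mu ->
    smooth_sect (nabla X mu);
  conn_linear_l : forall (f : M -> R) (X Y : sect F) (mu : sect E),
    smooth f -> smooth_sect X -> smooth_sect Y -> smooth_sect mu ->
    forall x, nabla (fun y => f y *: X y + Y y) mu x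
              = f x *: nabla X mu x + nabla Y mu x;
  conn_linear_r : forall (c : R) (X : sect F) (mu nu : sect E),
    smooth_sect X -> smooth_sect mu -> smooth_sect nu ->
    forall x, nabla X (fun y => c *: mu y + nu y) x
              = c *: nabla X mu x + nabla X nu x;
  conn_leibniz : forall (f : M -> R) (X : sect F) (mu : sect E),
    smooth f -> smooth_sect X -> smooth_sect mu ->
    forall x, nabla X (fun y => f y *: mu y) x
              = f x *: nabla X mu x + anchor (X x) f *: mu x }.

Definition is_flat (F : pre_algebroid M) (E : vbundle M)
    (nabla : sect F -> sect E -> sect E) : Prop :=
  forall (X Y : sect F) (mu : sect E),
    smooth_sect X -> smooth_sect Y -> smooth_sect mu ->
    forall x, nabla X (nabla Y mu) x - nabla Y (nabla X mu) x
              = nabla (la_br X Y) mu x.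

End BLA.

Record pre_crossed_module (R : realType) (M : manifold R) :=
  PreCrossedModule {
  cm_E : pre_bla M;
  cm_F : pre_algebroid M;
  cm_K : forall x, cm_E x -> cm_F x;
  cm_nabla : sect cm_F -> sect cm_E -> sect cm_E }.

Section CrossedModules.
Variables (R : realType) (M : manifold R).

Record is_crossed_module (C : pre_crossed_module M) : Prop :=
  IsCrossedModule {
  cm_lab : is_LAB (cm_E C);
  cm_lie_algebroid : is_lie_algebroid (cm_F C);
  cm_morphism :
    @is_la_morphism R M (bla_algebroid (cm_E C)) (cm_F C) (@cm_K R M C);
  cm_connection : is_connection (@cm_nabla R M C);
  cm_flat : is_flat (@cm_nabla R M C);
  cm_derivation : forall (X : sect (cm_F C)) (mu nu : sect (cm_E C)),
    smooth_sect X -> smooth_sect mu -> smooth_sect nu ->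
    forall x, cm_nabla X (fun y => bla_br (mu y) (nu y)) x
              = bla_br (cm_nabla X mu x) (nu x)
                + bla_br (mu x) (cm_nabla X nu x);
  cm_equivariant : forall (X : sect (cm_F C)) (mu : sect (cm_E C)),
    smooth_sect X -> smooth_sect mu ->
    forall x, cm_K (cm_nabla X mu x) = la_br X (smap (@cm_K R M C) mu) x;
  cm_peiffer : forall mu nu : sect (cm_E C),
    smooth_sect mu -> smooth_sect nu ->
    forall x, cm_nabla (smap (@cm_K R M C) mu) nu x = bla_br (mu x) (nu x) }.

Variable C : pre_crossed_module M.
Local Notation E := (cm_E C).
Local Notation F := (cm_F C).
Local Notation K := (@cm_K R M C).
Local Notation nabla := (@cm_nabla R M C).

(* nabla^bas on E and on F; defined for any data, without using that it vanishes
   for a crossed module. *)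
Definition basE (mu nu : sect E) : sect E :=
  fun x => bla_br (mu x) (nu x) + nabla (smap K nu) mu x.

Definition basF (mu : sect E) (X : sect F) : sect F :=
  fun x => la_br (smap K mu) X x + K (nabla X mu x).

Definition Hbr (mu nu : sect E) : sect E :=
  fun x => basE mu nu x - basE nu mu x - bla_br (mu x) (nu x).

(* The strict BLA of [E] is the bundle [E] with the field of Lie brackets that
   induces [Hbr] on Gamma(E); as every vector of [E] is the value of a global
   smooth section, this determines the field [h]. *)
Definition is_strict_bla (h : forall x, E x -> E x -> E x) : Prop :=
  is_BLA (PreBLA h) /\
  forall mu nu : sect E, smooth_sect mu -> smooth_sect nu ->
    forall x, h x (mu x) (nu x) = Hbr mu nu x.

(* (E_H, -K, F, nabla), where [h] is the bracket of E_H. *)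
Definition strict_cm (h : forall x, E x -> E x -> E x) : pre_crossed_module M :=
  @PreCrossedModule R M (PreBLA h) F (fun x u => - K u) nabla.

Definition sandglass : pre_algebroid M :=
  @PreAlgebroid R M (dsum F E)
    (fun x a f => anchor a.1 f + @anchor R M (bla_algebroid E) x a.2 f)
    (fun s t =>
       let X : sect F := fun x => (s x).1 in
       let mu : sect E := fun x => (s x).2 in
       let Y : sect F := fun x => (t x).1 in
       let nu : sect E := fun x => (t x).2 in
       fun x => (la_br X Y x + basF mu Y x - basF nu X x,
                 bla_br (mu x) (nu x) + nabla X nu x - nabla Y mu x)).

Definition sg_ihat (x : M) (u : E x) : sandglass x := (0, u).
Definition sg_D (x : M) (a : sandglass x) : F x := a.1 + K a.2.
Definition sg_i (x : M) (u : E x) : sandglass x := (- K u, u).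
Definition sg_psi (x : M) (a : sandglass x) : F x := a.1.

End CrossedModules.

Record is_butterfly (R : realType) (M : manifold R)
    (C C' : pre_crossed_module M) (A : pre_algebroid M)
    (ihat : forall x, cm_E C x -> A x) (i : forall x, cm_E C' x -> A x)
    (D : forall x, A x -> cm_F C x) (psi : forall x, A x -> cm_F C' x)
    : Prop := IsButterfly {
  bf_lie_algebroid : is_lie_algebroid A;
  bf_ihat_morphism : @is_la_morphism R M (bla_algebroid (cm_E C)) A ihat;
  bf_i_morphism : @is_la_morphism R M (bla_algebroid (cm_E C')) A i;
  bf_D_morphism : is_la_morphism D;
  bf_psi_morphism : is_la_morphism psi;
  bf_commute : forall x (u : cm_E C x), D x (ihat x u) = cm_K u;
  bf_commute' : forall x (u : cm_E C' x), psi x (i x u) = cm_K u;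
  bf_exact : @is_ses R M (bla_algebroid (cm_E C')) A (cm_F C) i D;
  bf_complex : forall x (u : cm_E C x), psi x (ihat x u) = 0;
  bf_action : forall (xi : sect A) (mu : sect (cm_E C)),
    smooth_sect xi -> smooth_sect mu ->
    forall x, la_br xi (smap ihat mu) x = ihat x (cm_nabla (smap D xi) mu x);
  bf_action' : forall (xi : sect A) (nu : sect (cm_E C')),
    smooth_sect xi -> smooth_sect nu ->
    forall x, la_br xi (smap i nu) x = i x (cm_nabla (smap psi xi) nu x) }.

(* Main.v *)
Require Import Defs.
From HB Require Import structures.
From mathcomp Require Import all_boot all_order all_algebra.
From mathcomp Require Import all_classical all_reals all_analysis.

(** The Peiffer identity nabla_(K mu) nu = [mu, nu] expresses the bracket of E
    through K and nabla, and it shows that changing the sign of K changes the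
    sign of the bracket.  The other axioms survive this change of signs: the
    derivation property is linear in the bracket, equivariance is linear in K,
    and in K [mu, nu] = [K mu, K nu] each side contains two of the quantities
    that change sign.  Hence (E_H, -K, F, nabla), with E_H carrying the opposite
    bracket, is again a crossed module ([opp_crossed_module]).  That the
    opposite bracket is the bracket H follows from the vanishing of the basic
    connection on E ([basE_eq0], [opp_br_strict]).

    By the vanishing of the basic connection on F ([basF_eq0]) the bracket on
    A = F + E is the semidirect product bracket
      [(X, mu), (Y, nu)] = ([X, Y], [mu, nu] + nabla_X nu - nabla_Y mu).
    Its E-component satisfies the Jacobi identity because nabla is flat and acts
    by derivations: after expanding one double bracket ([sgE_double_br]), all
    terms but the double brackets of E cancel in the cyclic sum
    ([jacobi_cancel]).  The Leibniz rules of F and of nabla give that of A.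

    The two actions required of a butterfly, [sg_ihat_action] and
    [sg_i_action], are direct computations with this bracket; the fact that
    ihat and i preserve brackets is the special case where the section of A
    itself comes from E.  For D, equivariance of K turns the mixed terms
    nabla_X nu and nabla_Y mu into the mixed terms of [X + K mu, Y + K nu].
    Exactness of both diagonals is fibrewise linear algebra: D is split by
    X |-> (X, 0), and D (X, mu) = 0 means X = - K mu.

    The rest is differential calculus.  Brackets and connections are governed by
    their axioms on smooth sections only, so each step has to know that the
    sections it manipulates are smooth.  This reduces to closure of smooth
    functions under sums and products and to locality of smoothness, which is
    what makes a section of F + E smooth exactly when its components are
    ([smooth_dsum_on]). *)

Import Order.TTheory GRing.Theory Num.Theory numFieldNormedType.Exports.

Set Implicit Arguments.
Unset Strict Implicit.
Unset Printing Implicit Defensive.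

Local Open Scope classical_set_scope.
Local Open Scope ring_scope.

(** * Calculus of C^k functions *)

Lemma near_eq_continuous (T U : topologicalType) (f g : T -> U) (x : T) :
  (\near x, f x = g x) ->
  {for x, continuous f} -> {for x, continuous g}.
Proof.
move=> fg; rewrite /prop_for /continuous_at (nbhs_singleton fg).
by apply: cvg_trans; apply: near_eq_cvg; apply: filterS fg.
Qed.

Section CkCalculus.
Variables (R : realType) (n : nat).
Implicit Types (f g : 'rV[R]_n -> R) (U : set 'rV[R]_n).

(** The induction on [k] uses openness of [U]: two functions equal on [U] then
    agree near each point of [U], so their partial derivatives agree on [U]. *)
Lemma Ck_congr k U f g : open U -> (forall x, U x -> f x = g x) ->
  Ck k U f -> Ck k U g.
Proof.
move=> oU; elim: k f g => [|k IH] f g fg /= [fc fd].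
all: have near_fg x : U x -> \near x, f x = g x
  by move=> Ux; near=> y; apply: fg; near: y; exact: open_nbhs_nbhs.
all: split=> [x Ux|//].
1,2: by apply: near_eq_continuous (fc x Ux); exact: near_fg.
move=> i; have [di Ci] := fd i; split.
  by move=> x Ux; apply: near_eq_derivable (di x Ux); exact: near_fg.
by apply: IH Ci => x Ux; apply: near_eq_derive; exact: near_fg.
Unshelve. all: by end_near. Qed.

Lemma Ck_pred k U f : Ck k.+1 U f -> Ck k U f.
Proof.
elim: k f => [|k IH] f [fc fd]; first by split.
by split=> // i; have [di /IH ?] := fd i; split.
Qed.

Lemma Ck_cst k U (a : R) : Ck k U (cst a).
Proof.
elim: k a => [|k IH] a /=; split=> //; try by move=> x _; exact: cst_continuous.
move=> i; split=> [x _|]; first exact: derivable_cst.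
have -> : 'D_'e_i (cst a) = cst 0 :> ('rV[R]_n -> R).
  by apply/funext => x; exact: derive_cst.
exact: IH.
Qed.

Lemma Ck_add k U f g : open U -> Ck k U f -> Ck k U g -> Ck k U (f + g).
Proof.
move=> oU; elim: k f g => [|k IH] f g /= [fc fd] [gc gd].
all: split=> [x Ux|//]; first by exact: continuousD (fc x Ux) (gc x Ux).
move=> i; have [dfi Cf] := fd i; have [dgi Cg] := gd i; split=> [x Ux|].
  exact: derivableD (dfi x Ux) (dgi x Ux).
apply: (Ck_congr oU) (IH _ _ Cf Cg) => x Ux.
by rewrite (deriveD (dfi x Ux) (dgi x Ux)).
Qed.

Lemma Ck_mul k U f g : open U -> Ck k U f -> Ck k U g -> Ck k U (f * g).
Proof.
move=> oU; elim: k f g => [|k IH] f g /= Cf Cg.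
all: have [fc fd] := Cf; have [gc gd] := Cg.
all: split=> [x Ux|//]; first by exact: continuousM (fc x Ux) (gc x Ux).
move=> i; have [dfi Dfi] := fd i; have [dgi Dgi] := gd i; split=> [x Ux|].
  exact: derivableM (dfi x Ux) (dgi x Ux).
apply: (Ck_congr oU) (Ck_add oU (IH _ _ (Ck_pred Cf) Dgi)
  (IH _ _ (Ck_pred Cg) Dfi)).
by move=> x Ux; rewrite (deriveM (dfi x Ux) (dgi x Ux)).
Qed.

(** [Ck] is a conjunction of conditions at the points of [U], so the cover may
    be arbitrary. *)
Lemma Ck_cover k U f (I : Type) (V : I -> set 'rV[R]_n) :
  (forall x, U x -> exists i, V i x) -> (forall i, Ck k (V i) f) -> Ck k U f.
Proof.
move=> UV; elim: k f => [|k IH] f VC /=; split=> //.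
- by move=> x /UV[i Vx]; have [+ _] := VC i; apply.
- by move=> x /UV[i Vx]; have [+ _] := VC i; apply.
move=> j; split=> [x /UV[i Vx]|].
  by have [_ /(_ j)[+ _]] := VC i; apply.
by apply: IH => i; have [_ /(_ j)[]] := VC i.
Qed.

End CkCalculus.

(** * Smooth functions on a manifold *)

Section SmoothCalculus.
Variables (R : realType) (M : manifold R).
Implicit Types (U : set M) (f g : M -> R).

(** Openness in R^n is what lets the C^k calculus apply in a chart; it comes
    from continuity of the inverse chart on the open image of the chart. *)
Lemma chart_img_open (c : chart R M (mdim M)) U :
  atlas c -> open U -> open (cmap c @` (U `&` cdom c)).
Proof.
move=> /atlas_chart hc oU.
have cK x : cdom c x -> cinv c (cmap c x) = x by exact: cmapK.
have -> : cmap c @` (U `&` cdom c)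
    = (cinv c @^-1` U) `&` (cmap c @` cdom c).
  apply/seteqP; split=> y /=.
    move=> [x [Ux cx] <-]; split; last by exists x.
    by rewrite /preimage /= cK.
  move=> [Uy [x cx xy]]; move: Uy; rewrite -xy /preimage /= cK // => Ux.
  by exists x.
rewrite open_setIS; last exact: cimg_open hc.
by move/continuousP: (cinv_cont hc); apply.
Qed.

Lemma smooth_on_congr U f g : open U -> (forall x, U x -> f x = g x) ->
  smooth_on U f -> smooth_on U g.
Proof.
move=> oU fg Uf c ca k; apply: Ck_congr (Uf c ca k).
  exact: chart_img_open.
by move=> _ [x [Ux cx] <-] /=; rewrite (cmapK (atlas_chart ca) cx) fg.
Qed.

Lemma smooth_on_cst U (a : R) : smooth_on U (fun=> a).
Proof. by move=> c _ k; exact: Ck_cst. Qed.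

Lemma smooth_on_add U f g : open U ->
  smooth_on U f -> smooth_on U g -> smooth_on U (fun x => f x + g x).
Proof.
by move=> oU Uf Ug c ca k; apply: Ck_add (Uf c ca k) (Ug c ca k);
  exact: chart_img_open.
Qed.

Lemma smooth_on_mul U f g : open U ->
  smooth_on U f -> smooth_on U g -> smooth_on U (fun x => f x * g x).
Proof.
by move=> oU Uf Ug c ca k; apply: Ck_mul (Uf c ca k) (Ug c ca k);
  exact: chart_img_open.
Qed.

Lemma smooth_on_cover U f (I : Type) (V : I -> set M) :
  (forall x, U x -> exists i, V i x) -> (forall i, smooth_on (V i) f) ->
  smooth_on U f.
Proof.
move=> UV Vf c ca k.
apply: (Ck_cover (V := fun i => cmap c @` (V i `&` cdom c))).
  by move=> _ [x [/UV[i Vx] cx] <-]; exists i, x.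
by move=> i; exact: Vf.
Qed.

End SmoothCalculus.

(** * Smooth sections *)

Section SectionCalculus.
Variables (R : realType) (M : manifold R).
Implicit Types (E F : vbundle M) (U : set M).

Lemma triv_lin E (t : ltriv E (rk E)) x (a : R) (u v : E x) :
  trivs t -> tdom t x -> tmap t (a *: u + v) = a *: tmap t u + tmap t v.
Proof. by move=> tE tx; rewrite (triv_linear tE tx). Qed.

Lemma eq_sect E (s t : sect E) : (forall x, s x = t x) -> s = t.
Proof. exact: functional_extensionality_dep. Qed.

Lemma smooth_sect_on_ext E U (s t : sect E) : (forall x, s x = t x) ->
  smooth_sect_on U s -> smooth_sect_on U t.
Proof. by move=> /eq_sect st; rewrite st. Qed.

Lemma smooth_sect_on_lin E U (f : M -> R) (s t : sect E) : open U ->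
  smooth_on U f -> smooth_sect_on U s -> smooth_sect_on U t ->
  smooth_sect_on U (fun x => f x *: s x + t x).
Proof.
move=> oU Uf Us Ut w wE i.
have oV : open (U `&` tdom w) by apply: openI => //; exact: triv_open.
have Vf : smooth_on (U `&` tdom w) f by apply: smooth_on_subset Uf => x [].
apply: (smooth_on_congr oV) (smooth_on_add oV
  (smooth_on_mul oV Vf (Us w wE i)) (Ut w wE i)).
by move=> x [_ wx]; rewrite (triv_lin _ _ _ wE wx) !mxE.
Qed.

Lemma smooth_sect_on0 E U : open U -> smooth_sect_on U (fun x => 0 : E x).
Proof.
move=> oU w wE i.
have oV : open (U `&` tdom w) by apply: openI => //; exact: triv_open.
apply: (smooth_on_congr oV) (@smooth_on_cst R M _ 0) => x [_ wx].
have := triv_lin 0 0 0 wE wx; rewrite !scale0r !add0r => tw0.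
have := triv_lin (-1) 0 0 wE wx.
by rewrite scaler0 add0r scaleN1r addNr => ->; rewrite mxE.
Qed.

Lemma smooth_sect_onZ E U (f : M -> R) (s : sect E) : open U ->
  smooth_on U f -> smooth_sect_on U s ->
  smooth_sect_on U (fun x => f x *: s x).
Proof.
move=> oU Uf Us; have := smooth_sect_on_lin oU Uf Us (smooth_sect_on0 oU).
by apply: smooth_sect_on_ext => x; rewrite addr0.
Qed.

Lemma smooth_sect_onD E U (s t : sect E) : open U ->
  smooth_sect_on U s -> smooth_sect_on U t ->
  smooth_sect_on U (fun x => s x + t x).
Proof.
move=> oU Us Ut; have := smooth_sect_on_lin oU (@smooth_on_cst R M U 1) Us Ut.
by apply: smooth_sect_on_ext => x; rewrite scale1r.
Qed.

Lemma smooth_sect_onN E U (s : sect E) : open U ->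
  smooth_sect_on U s -> smooth_sect_on U (fun x => - s x).
Proof.
move=> oU Us; have := smooth_sect_onZ oU (@smooth_on_cst R M U (-1)) Us.
by apply: smooth_sect_on_ext => x; rewrite scaleN1r.
Qed.

(** A trivialisation of F + E is a pair of trivialisations, and is defined only
    where both are.  To read off smoothness of the F-component in a
    trivialisation [t] of F, one therefore covers the domain of [t] by the
    domains of the trivialisations of E, and conversely. *)
Lemma smooth_dsum_on F E U (s : sect (dsum F E)) :
  smooth_sect_on U s <->
  smooth_sect_on U (fun x => (s x).1 : F x) /\
  smooth_sect_on U (fun x => (s x).2 : E x).
Proof.
split=> [Us|[UF UE] _ [t [w [tF wE ->]]] i /=].
  split=> t tT i.
    apply: (smooth_on_cover (I := {w : ltriv E (rk E) | trivs w})
      (V := fun w => U `&` (tdom t `&` tdom (sval w))))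
      => [x [Ux tx]|[w wE] /=].
      by have [w wE wx] := triv_cover E x; exists (exist _ w wE).
    have dT : trivs (dsum_triv t w : ltriv (dsum F E) _) by exists t, w.
    have := Us _ dT (lshift _ i); congr smooth_on.
    by apply/funext => x /=; rewrite row_mxEl.
  apply: (smooth_on_cover (I := {w : ltriv F (rk F) | trivs w})
    (V := fun w => U `&` (tdom (sval w) `&` tdom t))) => [x [Ux tx]|[w wF] /=].
    by have [w wF wx] := triv_cover F x; exists (exist _ w wF).
  have dT : trivs (dsum_triv w t : ltriv (dsum F E) _) by exists w, t.
  have := Us _ dT (rshift _ i); congr smooth_on.
  by apply/funext => x /=; rewrite row_mxEr.
case: (split_ordP i) => j ->.
- under eq_fun do rewrite row_mxEl.
  by apply: smooth_on_subset (UF t tF j) => x [? []].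
- under eq_fun do rewrite row_mxEr.
  by apply: smooth_on_subset (UE w wE j) => x [? []].
Qed.

End SectionCalculus.

(** * Linear maps and Lie brackets on a fibre *)

Section LinearMaps.
Variables (R : realType) (V W : lmodType R) (phi : V -> W).
Hypothesis phi_lin : linear phi.

Lemma linear_fun0 : phi 0 = 0.
Proof.
by have := phi_lin (-1) 0 0; rewrite scaler0 add0r scaleN1r addNr.
Qed.

Lemma linear_funD u v : phi (u + v) = phi u + phi v.
Proof. by have := phi_lin 1 u v; rewrite !scale1r. Qed.

Lemma linear_funN u : phi (- u) = - phi u.
Proof. by have := phi_lin (-1) u 0; rewrite linear_fun0 !addr0 !scaleN1r. Qed.

Lemma linear_funZ (a : R) u : phi (a *: u) = a *: phi u.
Proof. by have := phi_lin a u 0; rewrite linear_fun0 !addr0. Qed.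

End LinearMaps.

Section LieBracketTheory.
Variables (R : realType) (V : lmodType R) (br : V -> V -> V).
Hypothesis hbr : is_lie_bracket br.

Lemma lieDl u v w : br (u + v) w = br u w + br v w.
Proof. by apply: (linear_funD (phi := br^~ w)) => a ? ?; exact: lie_linear. Qed.

Lemma lieNl u v : br (- u) v = - br u v.
Proof. by apply: (linear_funN (phi := br^~ v)) => a ? ?; exact: lie_linear. Qed.

Lemma lieDr u v w : br u (v + w) = br u v + br u w.
Proof. by rewrite lie_skew // lieDl opprD -!lie_skew. Qed.

Lemma lieNr u v : br u (- v) = - br u v.
Proof. by rewrite lie_skew // lieNl -lie_skew. Qed.

Lemma lieZr (a : R) u v : br u (a *: v) = a *: br u v.
Proof.
have -> : br u (a *: v) = - br (a *: v) u by exact: lie_skew.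
have -> : br (a *: v) u = a *: br v u.
  by apply: (linear_funZ (phi := br^~ u)) => b ? ?; exact: lie_linear.
by rewrite -scalerN -lie_skew.
Qed.

Lemma opp_lie_bracket : is_lie_bracket (fun u v => - br u v).
Proof.
split=> [u v|c u v w|u v w]; first by rewrite -(lie_skew hbr u v).
  by rewrite lie_linear // opprD scalerN.
by rewrite !lieNr !opprK lie_jacobi.
Qed.

End LieBracketTheory.

(** * Operations on sections that are linear over the constants *)

Section ConstantCoefficients.
Variables (R : realType) (M : manifold R).

Lemma smooth_sectD (E : vbundle M) (s t : sect E) :
  smooth_sect s -> smooth_sect t -> smooth_sect (fun x => s x + t x).
Proof. exact: smooth_sect_onD openT. Qed.

Lemma smooth_sectN (E : vbundle M) (s : sect E) :
  smooth_sect s -> smooth_sect (fun x => - s x).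
Proof. exact: smooth_sect_onN openT. Qed.

Lemma smooth_sect0 (E : vbundle M) : smooth_sect (fun x => 0 : E x).
Proof. exact: smooth_sect_on0 openT. Qed.

Lemma smooth_sectZ (E : vbundle M) (f : M -> R) (s : sect E) :
  smooth f -> smooth_sect s -> smooth_sect (fun x => f x *: s x).
Proof. exact: smooth_sect_onZ openT. Qed.

(** Brackets and connections act on all set-theoretic sections but are
    constrained on smooth ones only, so they are not linear maps between spaces
    of sections; this predicate isolates what they share in each argument. *)
Definition sect_linear (E G : vbundle M) (T : sect E -> sect G) : Prop :=
  forall (c : R) (s t : sect E), smooth_sect s -> smooth_sect t ->
  forall x, T (fun y => c *: s y + t y) x = c *: T s x + T t x.

Section Rules.
Variables (E G : vbundle M) (T : sect E -> sect G).
Hypothesis T_lin : sect_linear T.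

Lemma sect_linear0 x : T (fun y => 0) x = 0.
Proof.
have := T_lin (-1) (@smooth_sect0 E) (@smooth_sect0 E) x.
rewrite scaleN1r addNr; congr (_ = _); congr (T _ x).
by apply: eq_sect => y; rewrite scaler0 addr0.
Qed.

Lemma sect_linearD s t : smooth_sect s -> smooth_sect t ->
  forall x, T (fun y => s y + t y) x = T s x + T t x.
Proof.
move=> ss st x; rewrite -[T s x]scale1r -T_lin //; congr (T _ x).
by apply: eq_sect => y; rewrite scale1r.
Qed.

Lemma sect_linearN s : smooth_sect s ->
  forall x, T (fun y => - s y) x = - T s x.
Proof.
move=> ss x; rewrite -scaleN1r -[RHS]addr0 -(sect_linear0 x) -T_lin //.
  by congr (T _ x); apply: eq_sect => y; rewrite scaleN1r addr0.
exact: smooth_sect0.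
Qed.

End Rules.
End ConstantCoefficients.

Section AlgebroidRules.
Variables (R : realType) (M : manifold R).
Variables (A : pre_algebroid M) (hA : is_lie_algebroid A).

Lemma la_br_linear_l (t : sect A) : smooth_sect t ->
  sect_linear (fun s => la_br s t).
Proof. by move=> st c r s sr ss x; exact: la_br_linear. Qed.

Lemma la_br_linear_r (s : sect A) : smooth_sect s ->
  sect_linear (fun t => la_br s t).
Proof.
move=> ss c r t sr st x.
have lr : smooth_sect (fun y => c *: r y + t y).
  exact: (smooth_sect_on_lin openT (@smooth_on_cst _ _ _ c)).
rewrite (la_br_skew hA ss lr) (la_br_linear hA c sr st ss) opprD -scalerN.
by rewrite -!(la_br_skew hA).
Qed.

Lemma anchor0 x (f : M -> R) : smooth f -> anchor (0 : A x) f = 0.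
Proof.
move=> sf; have := anchor_linear hA (-1) (0 : A x) 0 sf.
by rewrite scaler0 add0r mulN1r addNr.
Qed.

End AlgebroidRules.

Section ConnectionRules.
Variables (R : realType) (M : manifold R).
Variables (F : pre_algebroid M) (E : vbundle M).
Variable nabla : sect F -> sect E -> sect E.
Hypothesis h : is_connection nabla.

Lemma conn_sect_linear_l (mu : sect E) : smooth_sect mu ->
  sect_linear (nabla^~ mu).
Proof.
move=> smu c X Y sX sY x.
exact: (conn_linear_l h (@smooth_on_cst _ _ _ c)).
Qed.

Lemma conn_sect_linear_r (X : sect F) : smooth_sect X ->
  sect_linear (nabla X).
Proof. by move=> sX c mu nu smu snu x; exact: conn_linear_r. Qed.

Lemma conn_scale_l (f : M -> R) (X : sect F) (mu : sect E) : smooth f ->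
  smooth_sect X -> smooth_sect mu ->
  forall x, nabla (fun y => f y *: X y) mu x = f x *: nabla X mu x.
Proof.
move=> sf sX smu x; rewrite -[RHS]addr0.
rewrite -(sect_linear0 (conn_sect_linear_l smu) x).
rewrite -(conn_linear_l h) //; last exact: smooth_sect0.
by congr (nabla _ _ x); apply: eq_sect => y; rewrite addr0.
Qed.

End ConnectionRules.

(** * The opposite crossed module *)

Section CrossedModuleTheory.
Variables (R : realType) (M : manifold R) (C : pre_crossed_module M).
Hypothesis hC : is_crossed_module C.
Local Notation E := (cm_E C).
Local Notation F := (cm_F C).
Local Notation K := (@cm_K R M C).
Local Notation nabla := (@cm_nabla R M C).
Local Notation hF := (cm_lie_algebroid hC).
Local Notation hN := (cm_connection hC).
Implicit Types (mu nu : sect E) (X Y : sect F).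

Lemma cm_K_linear x : linear (@cm_K R M C x).
Proof. exact: (bmap_linear (lam_bundle_map (cm_morphism hC))). Qed.

Lemma cm_K_smooth (U : set M) mu : open U ->
  smooth_sect_on U mu -> smooth_sect_on U (smap K mu).
Proof. exact: (bmap_smooth (lam_bundle_map (cm_morphism hC))). Qed.

Lemma cm_K_smooth_sect mu : smooth_sect mu -> smooth_sect (smap K mu).
Proof. exact: cm_K_smooth openT. Qed.

Lemma cm_lie x : is_lie_bracket (@bla_br R M E x).
Proof. exact: bla_bracket (lab_bla (cm_lab hC)) x. Qed.

Lemma cm_br_smooth mu nu : smooth_sect mu -> smooth_sect nu ->
  smooth_sect (fun x => bla_br (mu x) (nu x) : E x).
Proof. exact: (bla_smooth (lab_bla (cm_lab hC)) openT). Qed.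

Lemma cm_K_anchor x (u : E x) (f : M -> R) : smooth f -> anchor (K u) f = 0.
Proof. exact: (lam_anchor (cm_morphism hC)). Qed.

Lemma cm_K_br mu nu : smooth_sect mu -> smooth_sect nu ->
  forall x, K (bla_br (mu x) (nu x)) = la_br (smap K mu) (smap K nu) x.
Proof. exact: (lam_br (cm_morphism hC)). Qed.

(** Equivariance of K and skew-symmetry of the bracket of F. *)
Lemma basF_eq0 mu X : smooth_sect mu -> smooth_sect X ->
  forall x, basF mu X x = 0.
Proof.
move=> smu sX x; have sK := cm_K_smooth_sect smu.
by rewrite /basF (cm_equivariant hC) // (la_br_skew hF sK sX) addNr.
Qed.

(** The Peiffer identity and skew-symmetry of the bracket of E. *)
Lemma basE_eq0 mu nu : smooth_sect mu -> smooth_sect nu ->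
  forall x, basE mu nu x = 0.
Proof.
move=> smu snu x.
by rewrite /basE (cm_peiffer hC) // (lie_skew (cm_lie x)) addNr.
Qed.

Definition opp_br x (u v : E x) : E x := - bla_br u v.

Lemma opp_br_BLA : is_BLA (PreBLA opp_br).
Proof.
split=> [x|U s t oU Us Ut]; first exact: opp_lie_bracket (cm_lie x).
exact: smooth_sect_onN oU (bla_smooth (lab_bla (cm_lab hC)) oU Us Ut).
Qed.

Lemma opp_br_strict : is_strict_bla opp_br.
Proof.
split=> [|mu nu smu snu x]; first exact: opp_br_BLA.
by rewrite /Hbr !basE_eq0 // subr0 add0r.
Qed.

Lemma smapN mu : smap (fun x (u : E x) => - K u) mu = fun x => - smap K mu x.
Proof. by []. Qed.

(** An isomorphism between two fibres for the brackets of E is one for their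
    opposites, so E_H is again a Lie algebra bundle; in the remaining axioms the
    signs of the bracket and of K match. *)
Lemma opp_crossed_module : is_crossed_module (strict_cm opp_br).
Proof.
split=> /=.
- split=> [|x y]; first exact: opp_br_BLA.
  have [phi [phi_lin phi_bij phi_br]] := lab_iso (cm_lab hC) x y.
  exists phi; split=> // u v.
  by rewrite /= /opp_br (linear_funN phi_lin) phi_br.
- exact: hF.
- split=> /=.
  + split=> [x a u v|U s oU Us].
      by rewrite cm_K_linear opprD scalerN.
    exact: smooth_sect_onN oU (cm_K_smooth oU Us).
  + move=> x u f sf.
    by rewrite -(linear_funN (@cm_K_linear x)) cm_K_anchor.
  + move=> s t ss st x; have sK := cm_K_smooth_sect.
    rewrite /opp_br (linear_funN (@cm_K_linear x)) opprK cm_K_br //.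
    rewrite smapN smapN.
    have sKs := sK _ ss; have sKt := sK _ st.
    rewrite (sect_linearN (la_br_linear_l hF (smooth_sectN sKt))) //.
    by rewrite (sect_linearN (la_br_linear_r hF sKs)) ?opprK.
- exact: hN.
- exact: cm_flat hC.
- move=> X mu nu sX smu snu x; rewrite /opp_br.
  rewrite (sect_linearN (conn_sect_linear_r hN sX)); last exact: cm_br_smooth.
  by rewrite (cm_derivation hC) // opprD.
- move=> X mu sX smu x; rewrite smapN.
  rewrite (sect_linearN (la_br_linear_r hF sX)); last exact: cm_K_smooth_sect.
  by rewrite (cm_equivariant hC).
- move=> mu nu smu snu x; rewrite smapN.
  have sK := cm_K_smooth_sect smu.
  rewrite (sect_linearN (conn_sect_linear_l hN snu)) //.
  by rewrite (cm_peiffer hC).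
Qed.

End CrossedModuleTheory.

(** * Cancellation of terms in the Jacobi identity *)

Section AbelianCancellation.
Variable V : zmodType.
Implicit Types a b c : V.

Lemma addrB_linear (R : pzRingType) (W : lmodType R) (k : R)
    (a1 a2 b1 b2 c1 c2 : W) :
  (k *: a1 + a2) + (k *: b1 + b2) - (k *: c1 + c2)
  = k *: (a1 + b1 - c1) + (a2 + b2 - c2).
Proof. by rewrite addrACA -scalerDr opprD addrACA -scalerN -scalerDr. Qed.

Lemma addrB_leibniz (R : pzRingType) (W : lmodType R) (k : R) (a b c d : W) :
  k *: a + (k *: b + d) - k *: c = k *: (a + b - c) + d.
Proof. by rewrite !scalerDr scalerN addrA [LHS]addrAC. Qed.

Lemma cyclic_sum_cancel a1 a2 a3 : (a1 - a2) + (a2 - a3) + (a3 - a1) = 0.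
Proof. by rewrite subrKA subrKA subrr. Qed.

Lemma addrACA3 a1 a2 a3 b1 b2 b3 :
  (a1 + b1) + (a2 + b2) + (a3 + b3) = (a1 + a2 + a3) + (b1 + b2 + b3).
Proof. by rewrite (addrACA a1) (addrACA (a1 + a2)). Qed.

Lemma cyclic_sum_cancel' a1 a2 a3 : (a1 - a2) + (a3 - a1) + (a2 - a3) = 0.
Proof. by rewrite addrAC cyclic_sum_cancel. Qed.

Lemma jacobi_regroup j b1 b2 b3 b4 c1 c2 d1 d2 :
  (j + b1 - b4) + ((- b2 + b3) + c1 - d2) - (c2 - d1)
  = j + (b1 - b2) + (b3 - b4) + (c1 - c2) + (d1 - d2).
Proof.
rewrite opprB.
by rewrite [LHS](AC (3 * 4 * 2) (1 * (2 * 4) * (5 * 3) * (6 * 9) * (8 * 7))).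
Qed.

(** Under cyclic permutation of three sections of the sandglass algebroid, each
    of the families [a], [b] (derivatives inside brackets), [c], [d] (second
    derivatives) telescopes. *)
Lemma jacobi_cancel j1 j2 j3 a1 a2 a3 b1 b2 b3 c1 c2 c3 d1 d2 d3 :
  j1 + j2 + j3 = 0 ->
  (j1 + (a1 - a3) + (b1 - b2) + (c1 - c2) + (d1 - d2))
  + (j2 + (a2 - a1) + (b3 - b1) + (c2 - c3) + (d2 - d3))
  + (j3 + (a3 - a2) + (b2 - b3) + (c3 - c1) + (d3 - d1)) = 0.
Proof.
move=> j0; rewrite (addrACA3 _ _ _ (d1 - d2)) cyclic_sum_cancel addr0.
rewrite (addrACA3 _ _ _ (c1 - c2)) cyclic_sum_cancel addr0.
rewrite (addrACA3 _ _ _ (b1 - b2)) cyclic_sum_cancel' addr0.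
by rewrite (addrACA3 _ _ _ (a1 - a3)) cyclic_sum_cancel' addr0.
Qed.

End AbelianCancellation.

(** * The sandglass algebroid *)

Section Sandglass.
Variables (R : realType) (M : manifold R) (C : pre_crossed_module M).
Hypothesis hC : is_crossed_module C.
Local Notation E := (cm_E C).
Local Notation F := (cm_F C).
Local Notation K := (@cm_K R M C).
Local Notation nabla := (@cm_nabla R M C).
Local Notation A := (sandglass C).
Local Notation hF := (cm_lie_algebroid hC).
Local Notation hN := (cm_connection hC).
Implicit Types (mu nu la : sect E) (X Y Z : sect F) (s t : sect A).

Definition sgF s : sect F := fun x => (s x).1.
Definition sgE s : sect E := fun x => (s x).2.
Definition sg_pair X mu : sect A := fun x => (X x, mu x).

Lemma smooth_sgP s :
  smooth_sect s <-> smooth_sect (sgF s) /\ smooth_sect (sgE s).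
Proof. exact: smooth_dsum_on. Qed.

Lemma smooth_sg_pair X mu : smooth_sect X -> smooth_sect mu ->
  smooth_sect (sg_pair X mu).
Proof. by move=> sX smu; apply/smooth_sgP. Qed.

Lemma sg_pairE s : s = sg_pair (sgF s) (sgE s).
Proof.
by apply: eq_sect => x; rewrite /sg_pair -surjective_pairing.
Qed.

(** The basic connection on F vanishes on smooth sections, which leaves the
    semidirect product bracket. *)
Lemma sg_brE X mu Y nu : smooth_sect X -> smooth_sect mu ->
  smooth_sect Y -> smooth_sect nu ->
  la_br (sg_pair X mu) (sg_pair Y nu)
  = sg_pair (la_br X Y)
      (fun x => bla_br (mu x) (nu x) + nabla X nu x - nabla Y mu x).
Proof.
move=> sX smu sY snu; apply: eq_sect => x.
by rewrite /sg_pair /= !basF_eq0 // addr0 subr0.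
Qed.

Lemma sgE_br_smooth X mu Y nu : smooth_sect X -> smooth_sect mu ->
  smooth_sect Y -> smooth_sect nu ->
  smooth_sect
    (fun x => bla_br (mu x) (nu x) + nabla X nu x - nabla Y mu x : E x).
Proof.
move=> sX smu sY snu; apply: smooth_sectD; last first.
  by apply: smooth_sectN; exact: (conn_smooth hN).
apply: smooth_sectD; last exact: (conn_smooth hN).
exact: cm_br_smooth.
Qed.

(** The derivation property and flatness, with one skew-symmetry, bring the
    double bracket into a form where each difference cancels in the cyclic
    sum. *)
Lemma sgE_double_br X mu Y nu Z la : smooth_sect X -> smooth_sect mu ->
  smooth_sect Y -> smooth_sect nu -> smooth_sect Z -> smooth_sect la ->
  let w := fun x => bla_br (nu x) (la x) + nabla Y la x - nabla Z nu x : E x in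
  forall x, bla_br (mu x) (w x) + nabla X w x - nabla (la_br Y Z) mu x
  = bla_br (mu x) (bla_br (nu x) (la x))
    + (bla_br (mu x) (nabla Y la x) - bla_br (la x) (nabla X nu x))
    + (bla_br (nu x) (nabla X la x) - bla_br (mu x) (nabla Z nu x))
    + (nabla X (nabla Y la) x - nabla Y (nabla Z mu) x)
    + (nabla Z (nabla Y mu) x - nabla X (nabla Z nu) x).
Proof.
move=> sX smu sY snu sZ sla w x.
have sN := conn_smooth hN.
have sYl := sN _ _ sY sla; have sZn := sN _ _ sZ snu.
have sb := cm_br_smooth hC snu sla.
have lX := conn_sect_linear_r hN sX.
rewrite (sect_linearD lX (smooth_sectD sb sYl) (smooth_sectN sZn)).
rewrite (sect_linearD lX sb sYl) (sect_linearN lX sZn) (cm_derivation hC) //.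
rewrite -(cm_flat hC) // (lie_skew (cm_lie hC x) (nabla X nu x)).
rewrite /w !(lieDr (cm_lie hC x)) (lieNr (cm_lie hC x)).
exact: jacobi_regroup.
Qed.

Lemma sg_anchorE x (a : A x) : anchor a = anchor (a.1 : F x).
Proof. by apply/funext => f /=; rewrite addr0. Qed.

Lemma sandglass_algebroid : is_lie_algebroid A.
Proof.
split.
- by move=> x a; rewrite sg_anchorE; exact: (anchor_tangent hF).
- by move=> x c a b f sf; rewrite !sg_anchorE; exact: (anchor_linear hF).
- move=> U s f oU /smooth_dsum_on[UX _] sf.
  under eq_fun do rewrite sg_anchorE.
  exact: (anchor_smooth hF oU UX).
- move=> s t /smooth_sgP[sX smu] /smooth_sgP[sY snu].
  rewrite (sg_pairE s) (sg_pairE t) sg_brE //; apply: smooth_sg_pair.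
    exact: (la_br_smooth hF).
  exact: sgE_br_smooth.
- move=> s t /smooth_sgP[sX smu] /smooth_sgP[sY snu] x.
  rewrite (sg_pairE s) (sg_pairE t) !sg_brE //; congr pair.
    exact: (la_br_skew hF).
  by rewrite (lie_skew (cm_lie hC x)) !opprD opprK addrAC.
- move=> c r s t /smooth_sgP[sZ sla] /smooth_sgP[sX smu] /smooth_sgP[sY snu] x.
  rewrite (sg_pairE r) (sg_pairE s) (sg_pairE t) -/(sg_pair _ _).
  have sl G (v w : sect G) : smooth_sect v -> smooth_sect w ->
      smooth_sect (fun y => c *: v y + w y).
    exact: (smooth_sect_on_lin openT (@smooth_on_cst _ _ _ c)).
  rewrite [X in la_br X _](_ : _ = sg_pair
    (fun y => c *: sgF r y + sgF s y) (fun y => c *: sgE r y + sgE s y)) //.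
  rewrite !sg_brE //; try exact: sl.
  congr pair; first exact: (la_br_linear hF).
  rewrite (lie_linear (cm_lie hC x)) (conn_sect_linear_l hN snu) //.
  by rewrite (conn_linear_r hN) // addrB_linear.
- move=> r s t /smooth_sgP[sX smu] /smooth_sgP[sY snu] /smooth_sgP[sZ sla] x.
  have sF := la_br_smooth hF.
  rewrite (sg_pairE r) (sg_pairE s) (sg_pairE t).
  rewrite !sg_brE //; try exact: sF; try exact: sgE_br_smooth.
  congr pair; first exact: (la_br_jacobi hF).
  rewrite /= !sgE_double_br //.
  by apply: jacobi_cancel; exact: (lie_jacobi (cm_lie hC x)).
- move=> f s t sf /smooth_sgP[sX smu] /smooth_sgP[sY snu] x.
  have sZ G (v : sect G) : smooth_sect v -> smooth_sect (fun y => f y *: v y).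
    exact: smooth_sectZ.
  rewrite (sg_pairE s) (sg_pairE t).
  rewrite [X in la_br _ X](_ : _ = sg_pair
    (fun y => f y *: sgF t y) (fun y => f y *: sgE t y)) //.
  rewrite !sg_brE //; try exact: sZ.
  rewrite sg_anchorE; congr pair; first exact: (la_br_leibniz hF).
  rewrite (lieZr (cm_lie hC x)) (conn_leibniz hN) // (conn_scale_l hN) //.
  exact: addrB_leibniz.
- move=> s t f /smooth_sgP[sX smu] /smooth_sgP[sY snu] sf x.
  rewrite (sg_pairE s) (sg_pairE t) sg_brE // !sg_anchorE /=.
  rewrite (anchor_br hF) //.
  have addr0_anchor u : (fun y => anchor (sgF u y) f + 0)
      = (fun y => anchor (sgF u y) f) by apply/funext => y; rewrite addr0.
  by rewrite !addr0_anchor.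
Qed.

End Sandglass.

(** * The two diagonals *)

Section Diagonals.
Variables (R : realType) (M : manifold R) (C : pre_crossed_module M).
Hypothesis hC : is_crossed_module C.
Local Notation E := (cm_E C).
Local Notation F := (cm_F C).
Local Notation K := (@cm_K R M C).
Local Notation nabla := (@cm_nabla R M C).
Local Notation A := (sandglass C).
Local Notation E_H := (PreBLA (opp_br (C := C))).
Local Notation hF := (cm_lie_algebroid hC).
Local Notation hN := (cm_connection hC).
Local Notation K_lin x := (@cm_K_linear R M C hC x).
Implicit Types (mu nu : sect E) (X Y : sect F) (s t : sect A).

Lemma conn0l mu : smooth_sect mu -> forall x, nabla (fun=> 0) mu x = 0.
Proof. by move=> smu; exact: (sect_linear0 (conn_sect_linear_l hN smu)). Qed.

Lemma la_br0r X : smooth_sect X -> forall x, la_br X (fun=> 0) x = 0.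
Proof. by move=> sX; exact: (sect_linear0 (la_br_linear_r hF sX)). Qed.

Lemma la_brNr X Y : smooth_sect X -> smooth_sect Y ->
  forall x, la_br X (fun y => - Y y) x = - la_br X Y x.
Proof. by move=> sX; exact: (sect_linearN (la_br_linear_r hF sX)). Qed.

Lemma connNl X mu : smooth_sect X -> smooth_sect mu ->
  forall x, nabla (fun y => - X y) mu x = - nabla X mu x.
Proof. by move=> sX smu; exact: (sect_linearN (conn_sect_linear_l hN smu)). Qed.

Lemma sg_ihat_smap mu : smap (@sg_ihat R M C) mu = sg_pair (fun=> 0) mu.
Proof. by []. Qed.

Lemma sg_i_smap mu :
  smap (@sg_i R M C) mu = sg_pair (fun y => - smap K mu y) mu.
Proof. by []. Qed.

(** In the E-component, [mu, nu] is nabla_(K mu) nu, which completes nabla_X nu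
    to the derivative along D (X, mu). *)
Lemma sg_ihat_action s mu : smooth_sect s -> smooth_sect mu ->
  forall x, la_br s (smap (@sg_ihat R M C) mu) x
            = sg_ihat (cm_nabla (smap (@sg_D R M C) s) mu x).
Proof.
move=> /smooth_sgP[sX smu] snu x; have sK := cm_K_smooth_sect hC smu.
have s0 : smooth_sect (fun x => 0 : F x) by exact: smooth_sect0.
rewrite sg_ihat_smap (sg_pairE s) sg_brE //; congr pair; first exact: la_br0r.
rewrite conn0l // subr0 -(cm_peiffer hC) // addrC.
by rewrite -(sect_linearD (conn_sect_linear_l hN snu)).
Qed.

(** Here the Peiffer identity applied to nabla_(- K nu) mu cancels the bracket
    of E instead, which leaves the derivative along psi (X, mu) = X. *)
Lemma sg_i_action s mu : smooth_sect s -> smooth_sect mu ->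
  forall x, la_br s (smap (@sg_i R M C) mu) x
            = sg_i (cm_nabla (smap (@sg_psi R M C) s) mu x).
Proof.
move=> /smooth_sgP[sX smu] snu x; have sK := cm_K_smooth_sect hC snu.
have sNK := smooth_sectN sK.
rewrite sg_i_smap (sg_pairE s) sg_brE //; congr pair.
  by rewrite la_brNr // -(cm_equivariant hC).
rewrite connNl // (cm_peiffer hC) // opprK (lie_skew (cm_lie hC x)).
by rewrite addrAC addNr add0r.
Qed.

Lemma sg_i_smooth (U : set M) mu : open U -> smooth_sect_on U mu ->
  smooth_sect_on U (smap (@sg_i R M C) mu).
Proof.
move=> oU Umu; apply/smooth_dsum_on; split=> //.
exact: smooth_sect_onN oU (cm_K_smooth hC oU Umu).
Qed.

Lemma sg_ihat_smooth (U : set M) mu : open U -> smooth_sect_on U mu ->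
  smooth_sect_on U (smap (@sg_ihat R M C) mu).
Proof.
by move=> oU Umu; apply/smooth_dsum_on; split=> //; exact: smooth_sect_on0.
Qed.

Lemma sg_ihat_morphism :
  @is_la_morphism R M (bla_algebroid E) A (@sg_ihat R M C).
Proof.
split.
- split=> [x a u v|U mu]; last exact: sg_ihat_smooth.
  by congr pair; rewrite /= scaler0 addr0.
- by move=> x u f sf; rewrite sg_anchorE (anchor0 hF).
- move=> mu nu smu snu x.
  rewrite (sg_ihat_action (sg_ihat_smooth openT smu) snu).
  (* D (0, mu) = K mu, so the action formula is the Peiffer identity. *)
  congr (sg_ihat _); rewrite /= -(cm_peiffer hC) //.
  by congr (nabla _ _ x); apply: eq_sect => y; rewrite /smap /sg_D /= add0r.
Qed.

Lemma sg_i_morphism :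
  @is_la_morphism R M (bla_algebroid E_H) A (@sg_i R M C).
Proof.
split.
- split=> [x a u v|U mu]; last exact: sg_i_smooth.
  by congr pair; rewrite (K_lin x) opprD -scalerN.
- move=> x u f sf; rewrite sg_anchorE /= -(linear_funN (K_lin x)).
  exact: (cm_K_anchor hC).
- move=> mu nu smu snu x; have sK := cm_K_smooth_sect hC smu.
  rewrite (sg_i_action (sg_i_smooth openT smu) snu).
  congr (sg_i _); rewrite [RHS](_ : _ = nabla (fun y => - smap K mu y) nu x) //.
  by rewrite connNl // (cm_peiffer hC).
Qed.

(** In the expansion of [X + K mu, Y + K nu] the two mixed terms are
    K (nabla_X nu) and - K (nabla_Y mu) by equivariance, and the last one is
    K [mu, nu]. *)
Lemma sg_D_morphism : is_la_morphism (@sg_D R M C : forall x, A x -> F x).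
Proof.
split.
- split=> [x a u v|U s oU /smooth_dsum_on[UX Umu]].
    by rewrite /sg_D /= (K_lin x) scalerDr addrACA.
  exact: smooth_sect_onD oU UX (cm_K_smooth hC oU Umu).
- move=> x u f sf; rewrite sg_anchorE /sg_D -[u.1]scale1r (anchor_linear hF) //.
  by rewrite (cm_K_anchor hC) // mul1r addr0 scale1r.
- move=> s t /smooth_sgP[sX smu] /smooth_sgP[sY snu] x.
  have sKs := cm_K_smooth_sect hC smu; have sKt := cm_K_smooth_sect hC snu.
  rewrite [RHS](_ : _ = la_br (fun y => sgF s y + smap K (sgE s) y)
    (fun y => sgF t y + smap K (sgE t) y) x) //.
  have sDs := smooth_sectD sX sKs.
  rewrite (sect_linearD (la_br_linear_r hF sDs)) //.
  rewrite (sect_linearD (la_br_linear_l hF sY)) //.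
  rewrite (sect_linearD (la_br_linear_l hF sKt)) //.
  rewrite -(cm_K_br hC) // -(cm_equivariant hC) // (la_br_skew hF sKs) //.
  rewrite -(cm_equivariant hC) // (sg_pairE s) (sg_pairE t) sg_brE //.
  rewrite /sg_D /= !(linear_funD (K_lin x)) (linear_funN (K_lin x)).
  rewrite -[RHS]addrA; congr (_ + _).
  by rewrite [RHS]addrC; congr (_ - _); exact: addrC.
Qed.

Lemma sg_psi_morphism : is_la_morphism (@sg_psi R M C : forall x, A x -> F x).
Proof.
split.
- by split=> [x a u v //|U s oU /smooth_dsum_on[]].
- by move=> x u f sf; rewrite sg_anchorE.
- move=> s t /smooth_sgP[sX smu] /smooth_sgP[sY snu] x.
  by rewrite (sg_pairE s) (sg_pairE t) sg_brE.
Qed.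

Lemma sg_i_D_ses : @is_ses R M (bla_algebroid E_H) A F
  (@sg_i R M C) (@sg_D R M C).
Proof.
split=> [||x u v []//|x [X mu]|x X].
- exact: sg_i_morphism.
- exact: sg_D_morphism.
- rewrite /sg_D /=; split=> [/eqP|[u [-> ->]]]; last by rewrite addNr.
  by rewrite addr_eq0 => /eqP ->; exists mu.
- by exists (X, 0); rewrite /sg_D /= (linear_fun0 (K_lin x)) addr0.
Qed.

Lemma sg_ihat_psi_ses : @is_ses R M (bla_algebroid E) A F
  (@sg_ihat R M C) (@sg_psi R M C).
Proof.
split=> [||x u v []//|x [X mu]|x X].
- exact: sg_ihat_morphism.
- exact: sg_psi_morphism.
- by rewrite /sg_psi /=; split=> [->|[u [-> _]]] //; exists mu.
- by exists (X, 0).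
Qed.

Lemma sandglass_butterfly : @is_butterfly R M C (strict_cm (opp_br (C := C))) A
  (@sg_ihat R M C) (@sg_i R M C) (@sg_D R M C) (@sg_psi R M C).
Proof.
split=> //.
- exact: sandglass_algebroid.
- exact: sg_ihat_morphism.
- exact: sg_i_morphism.
- exact: sg_D_morphism.
- exact: sg_psi_morphism.
- by move=> x u; rewrite /sg_D /= add0r.
- exact: sg_i_D_ses.
- exact: sg_ihat_action.
- exact: sg_i_action.
Qed.

End Diagonals.

Theorem lemma4p13 (R : realType) (M : manifold R) (C : pre_crossed_module M)
    (hC : is_crossed_module C) :
  exists h : forall x : M, cm_E C x -> cm_E C x -> cm_E C x,
    [/\ is_strict_bla h,
        is_crossed_module (strict_cm h),
        @is_butterfly R M C (strict_cm h) (sandglass C)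
          (@sg_ihat R M C) (@sg_i R M C) (@sg_D R M C) (@sg_psi R M C),
        @is_ses R M (bla_algebroid (cm_E (strict_cm h))) (sandglass C) (cm_F C)
          (@sg_i R M C) (@sg_D R M C) &
        @is_ses R M (bla_algebroid (cm_E C)) (sandglass C) (cm_F (strict_cm h))
          (@sg_ihat R M C) (@sg_psi R M C)].
Proof.
exists (opp_br (C := C)); split.
- exact: opp_br_strict.
- exact: opp_crossed_module.
- exact: sandglass_butterfly.
- exact: sg_i_D_ses.
- exact: sg_ihat_psi_ses.
Qed.
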